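(* Let $n,s,k$ be integers with $k\geq 2$, $s\geq 3$ and $n\geq sk+1$. Then: (1) if $s(k+1)-1\leq n$, the graph $G(n,k,s)$ is isomorphic to $C_n^{s-1}$; (2) if $sk+1\leq n\leq s(k+1)-2$, then, writing $r=n-sk$, for $i,j\in[n]$ we have that $i$ and $j$ are adjacent in $G(n,k,s)$ if and only if $i\neq j$ and $|j-i|\notin\bigcup_{d=1}^{k-1}\{ds,ds+1,\dots,ds+r\}$ (here $|j-i|$ is the usual absolute value of the difference of the integers $i,j\in\{1,\dots,n\}$).
   Context: Let $[n]=\{1,\dots,n\}$. A subset $S\subseteq[n]$ is $s$-stable if for all distinct $i,j\in S$ we have $s\leq |i-j|\leq n-s$. $[n]^k_s$ denotes the family of $s$-stable $k$-element subsets of $[n]$. The graph $G(n,k,s)$ has vertex set $[n]$, and two distinct vertices $i,j$ are adjacent iff there is no $S\in[n]^k_s$ with $\{i,j\}\subseteq S$. $C_n$ is the cycle with vertex set $[n]$ and edges $\{i,i+1\}$ (indices modulo $n$, with $n$ playing the role of $0$), and $C_n^{q}$ is its $q$-th power: same vertex set, two distinct vertices adjacent iff their distance in $C_n$ is at most $q$. *)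

(* Defs.v *)
From mathcomp Require Import all_boot all_order all_algebra.

Set Implicit Arguments.
Unset Strict Implicit.
Unset Printing Implicit Defensive.

Import IntDist.

Local Open Scope nat_scope.

(** The ordinal [i : 'I_n] stands for the element [i.+1] of [{1, .., n}]. This
    shift preserves absolute differences and the cyclic successor [ordS], so
    every notion below reads as on [{1, .., n}]. *)

Definition stable n s (S : {set 'I_n}) : bool :=
  [forall i in S, forall j in S, (i != j) ==> (s <= `|i - j| <= n - s)].

Definition stable_sets n k s : {set {set 'I_n}} :=
  [set S : {set 'I_n} | (#|S| == k) && stable s S].

(** A graph on [T] is given by its adjacency relation. *)

Definition G n k s : rel 'I_n := fun i j =>
  (i != j) && ~~ [exists S in stable_sets n k s, [set i; j] \subset S].
Arguments G : clear implicits.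

Definition cycle_graph n : rel 'I_n := fun i j => (j == ordS i) || (i == ordS j).
Arguments cycle_graph : clear implicits.

Definition has_walk (T : finType) (e : rel T) (x y : T) (m : nat) : bool :=
  [exists p : m.-tuple T, path e x p && (last x p == y)].

(** A relation rather than a function: vertices in different components are at
    no finite distance. *)
Definition is_dist (T : finType) (e : rel T) (x y : T) (d : nat) : bool :=
  has_walk e x y d && [forall m : 'I_d, ~~ has_walk e x y m].

Definition graph_power (T : finType) (e : rel T) (q : nat) : rel T := fun x y =>
  (x != y) && [exists d : 'I_q.+1, is_dist e x y d].

Definition graph_iso (T1 T2 : finType) (e1 : rel T1) (e2 : rel T2) : Prop :=
  exists2 f : T1 -> T2, bijective f & forall x y, e2 (f x) (f y) = e1 x y.

Lemma G_irr n k s : irreflexive (G n k s).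
Proof. by move=> i; rewrite /G eqxx. Qed.

Lemma G_sym n k s : symmetric (G n k s).
Proof. by move=> i j; rewrite /G eq_sym setUC. Qed.

Lemma cycle_graph_sym n : symmetric (cycle_graph n).
Proof. by move=> i j; rewrite /cycle_graph orbC. Qed.

Lemma cycle_graph_irr n : 1 < n -> irreflexive (cycle_graph n).
Proof.
move=> n_gt1 i; rewrite /cycle_graph orbb; apply/eqP => /(congr1 val) /= /eqP.
have := ltn_ord i; rewrite leq_eqVlt => /orP[/eqP in_n | lt_in].
  by rewrite in_n modnn => /eqP i0; move: n_gt1; rewrite -in_n i0.
by rewrite modn_small // eqn_leq ltnn andbF.
Qed.

(* Main.v *)
(** Place the [s] points [x], [x + 1], .., [x + s - 1] (mod [n]) above each
    element [x] of a stable set [S]: these arcs are pairwise disjoint. If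
    [i < j] belong to [S] and [d] elements of [S] lie in [[i, j)], then the arcs
    of these [d] elements stay inside [[i, j)] and the others outside, whence
    [d * s <= j - i] and [(k - d) * s <= n - (j - i)]. Conversely, under these
    two inequalities the [d] points [i + t * s] and the [k - d] points
    [j + t * s] (mod [n]) form a stable set. So [i] and [j] are nonadjacent in
    [G n k s] iff [j - i] lies in a band [[d * s, d * s + r]] with
    [r = n - s * k]. When [r >= s - 1] the bands cover [[s, n - s]] without
    gaps, and what remains is cyclic distance less than [s]. *)

Require Import Defs.
From mathcomp Require Import all_boot all_order all_algebra.
From mathcomp Require Import zify.

Import IntDist.
Local Open Scope nat_scope.

(** * Stable sets and the arcs above their elements *)

Lemma modn_wrap m n : m < n + n -> m %% n = if m < n then m else m - n.
Proof.
case: (ltnP m n) => [lt_mn _|le_nm lt_m]; first by rewrite modn_small.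
by rewrite -{1}(subnK le_nm) modnDr modn_small //; lia.
Qed.

Lemma stableP n s (S : {set 'I_n}) :
  reflect {in S &, forall i j : 'I_n, i < j -> s <= j - i <= n - s}
          (stable s S).
Proof.
apply: (iffP idP) => [stS i j iS jS lt_ij|stS].
  move/forall_inP/(_ i iS)/forall_inP/(_ j jS)/implyP: stS.
  rewrite distnEr ?(ltnW lt_ij) //; apply.
  by rewrite -val_eqE /= neq_ltn lt_ij.
apply/forall_inP => i iS; apply/forall_inP => j jS; apply/implyP.
rewrite -val_eqE /= neq_ltn => /orP[] lt_ij.
  by rewrite distnEr ?(ltnW lt_ij) //; apply: stS.
by rewrite distnEl ?(ltnW lt_ij) //; apply: stS.
Qed.

Definition arc_point {n s} (u : 'I_n * 'I_s) : 'I_n :=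
  Ordinal (ltn_pmod (u.1 + u.2) (leq_ltn_trans (leq0n _) (ltn_ord u.1))).

Lemma arc_pointE n s (u : 'I_n * 'I_s) :
    s <= n ->
  arc_point u = (if u.1 + u.2 < n then u.1 + u.2 else u.1 + u.2 - n) :> nat.
Proof.
move=> le_sn.
by rewrite /= modn_wrap //; have := ltn_ord u.1; have := ltn_ord u.2; lia.
Qed.

(** For two elements of [S], the lower bound [s] on their difference keeps the arc of the smaller
    one below the larger one, and the upper bound [n - s] keeps the arc of the larger one, once
    wrapped, below the smaller one. *)
Lemma arc_point_inj n s (S : {set 'I_n}) :
    s <= n -> stable s S ->
  {in setX S [set: 'I_s] &, injective arc_point}.
Proof.
move=> le_sn stS [x t] [y u] /setXP[/= xS _] /setXP[/= yS _] /(congr1 (@nat_of_ord n)).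
rewrite !arc_pointE //=.
have [tS uS] := (ltn_ord t, ltn_ord u).
have [xn yn] := (ltn_ord x, ltn_ord y).
have [lt_xy|lt_yx|/val_inj eq_xy] := ltngtP x y.
- by have := stableP _ _ _ stS x y xS yS lt_xy; do 2!case: ifP; lia.
- by have := stableP _ _ _ stS y x yS xS lt_yx; do 2!case: ifP; lia.
rewrite {}eq_xy in xn * => eq_tu; congr (_, _); apply: val_inj => /=.
by move: eq_tu; do 2!case: ifP; lia.
Qed.

Lemma leq_card_arcs n s (S A B : {set 'I_n}) :
    s <= n -> stable s S -> A \subset S ->
    (forall x t, x \in A -> arc_point (x, t : 'I_s) \in B) ->
  #|A| * s <= #|B|.
Proof.
move=> le_sn stS sAS AB; rewrite -[s in _ * s]card_ord -cardsT -cardsX.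
rewrite -(card_in_imset (f := arc_point)); last first.
  by apply: sub_in2 (arc_point_inj _ _ _ le_sn stS); apply/subsetP/setXS.
by apply/subset_leq_card/subsetP => _ /imsetP[[x t] /setXP[/= /AB ? _] ->].
Qed.

(** * Stable sets through a given pair *)

Lemma card_ord_itv n (i j : 'I_n) : #|[set x : 'I_n | i <= x < j]| = j - i.
Proof.
rewrite -[RHS]muln1 -sum_nat_const_nat.
rewrite (big_nat_widen i j n) ?(ltnW (ltn_ord j)) //.
by rewrite big_geq_mkord -sum1_card; apply: eq_bigl => x; rewrite inE andbC.
Qed.

Lemma stable_pair_bands n k s (i j : 'I_n) (S : {set 'I_n}) :
    s <= n -> S \in stable_sets n k s -> i \in S -> j \in S -> i < j ->
  exists d, [/\ 0 < d < k, d * s <= j - i & (k - d) * s <= n - (j - i)].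
Proof.
move=> le_sn; rewrite inE => /andP[/eqP cardS stS] iS jS lt_ij.
pose I := [set x : 'I_n | i <= x < j]; exists #|S :&: I|.
have cardSD : #|S :\: I| = k - #|S :&: I| by rewrite cardsD cardS.
have SI_gt0 : 0 < #|S :&: I|.
  by apply/card_gt0P; exists i; rewrite !inE iS leqnn lt_ij.
have SD_gt0 : 0 < #|S :\: I|.
  by apply/card_gt0P; exists j; rewrite !inE jS ltnn andbF.
split; first by lia.
(* Since [j] is in [S], any [x < j] in [S] has [j - x >= s], so its arc ends before [j]. *)
- rewrite -card_ord_itv; apply: (leq_card_arcs _ _ _ _ _ le_sn stS (subsetIl _ _)) => x t.
  rewrite !inE => /and3P[xS le_ix lt_xj].
  have := stableP _ _ _ stS x j xS jS lt_xj.
  have := ltn_ord t; have := ltn_ord j.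
  by rewrite !arc_pointE //=; case: ifP; lia.
rewrite -cardSD -card_ord_itv -[n in n - _]card_ord -(cardsC I) addKn.
apply: (leq_card_arcs _ _ _ _ _ le_sn stS (subsetDl _ _)) => x t.
rewrite !inE => /andP[xI xS].
have := ltn_ord t; have := ltn_ord j; have := ltn_ord x.
rewrite !arc_pointE //=.
(* If [x < i], the arc ends before [i]. If [x > i], then [x >= j], and [x - i <= n - s] stops a
   wrapped arc before [i]. *)
have [lt_xi|lt_ix|/val_inj eq_xi] := ltngtP x i.
- by have := stableP _ _ _ stS x i xS iS lt_xi; case: ifP; lia.
- by have := stableP _ _ _ stS i x iS xS lt_ix; case: ifP; lia.
by rewrite eq_xi leqnn lt_ij in xI.
Qed.

Lemma bands_stable_pair n k s (i j : 'I_n) d :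
    0 < s -> i < j -> 0 < d < k -> d * s <= j - i ->
    (k - d) * s <= n - (j - i) ->
  exists2 S, S \in stable_sets n k s & [set i; j] \subset S.
Proof.
move=> s_gt0 lt_ij /andP[d_gt0 lt_dk] le_ds le_kds.
have [lt_in lt_jn] := (ltn_ord i, ltn_ord j).
have n_gt0 : 0 < n by apply: leq_ltn_trans lt_in.
pose g t := if t < d then t * s else j - i + (t - d) * s.
(* [g] is the offset from [i]. The jump from the first block to the second is wide enough by
   [le_ds], and the return to [i] around the cycle by [le_kds]. *)
have g_gap t u : t < u < k -> g t + s <= g u /\ g u + s <= g t + n.
  by rewrite /g => /andP[lt_tu lt_uk]; do 2!case: ifP => ?; split; nia.
have g_ltn t : t < k -> g t < n by rewrite /g; case: ifP => ? ?; nia.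
pose f (t : 'I_k) : 'I_n := Ordinal (ltn_pmod (i + g t) n_gt0).
have fE t : f t = (if i + g t < n then i + g t else i + g t - n) :> nat.
  by rewrite /= modn_wrap //; have := g_ltn t (ltn_ord t); lia.
(* Reduction mod [n] may reverse the order of the two points, hence the disjunction. *)
have f_gap (t u : 'I_k) : t < u ->
    (s <= f u - f t <= n - s) || (s <= f t - f u <= n - s).
  move=> lt_tu; have [] := g_gap t u; first by rewrite lt_tu ltn_ord.
  have := g_ltn t (ltn_ord t); have := g_ltn u (ltn_ord u).
  by rewrite !fE; do 2!case: ifP; lia.
have f_inj : injective f.
  move=> t u eq_ftu; apply: val_inj => /=.
  case: (ltngtP t u) => // /f_gap; rewrite eq_ftu; lia.
exists [set f t | t in 'I_k].
  rewrite inE card_imset // card_ord eqxx; apply/stableP.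
  move=> _ _ /imsetP[t _ ->] /imsetP[u _ ->] lt_f.
  case: (ltngtP t u) => [/f_gap|/f_gap|/val_inj eq_tu]; [lia..|].
  by rewrite eq_tu ltnn in lt_f.
(* [i] is the point of index [0] and [j] the point of index [d]. *)
apply/subsetP => x; rewrite !inE => /orP[]/eqP->; apply/imsetP.
  exists (Ordinal (ltn_trans d_gt0 lt_dk)) => //; apply: val_inj.
  by rewrite /= /g d_gt0 addn0 modn_small.
exists (Ordinal lt_dk) => //; apply: val_inj.
by rewrite /= /g ltnn subnn addn0 subnKC ?(ltnW lt_ij) // modn_small.
Qed.

(** Since [s * k <= n], the bound [(k - d) * s <= n - (j - i)] rearranges to
    [j - i <= d * s + (n - s * k)], the upper end of the band. *)
Lemma G_bands n k s (i j : 'I_n) :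
    0 < s -> s * k <= n -> 0 < k -> i < j ->
  G n k s i j <->
  ~ exists d, 1 <= d <= k - 1 /\ d * s <= j - i <= d * s + (n - s * k).
Proof.
move=> s_gt0 le_skn k_gt0 lt_ij.
have le_sn : s <= n by nia.
have lt_jn := ltn_ord j.
rewrite /G -val_eqE /= neq_ltn lt_ij /=; split.
  move=> /negP noS [d [d_k d_s]]; apply: noS; apply/exists_inP.
  by apply: (bands_stable_pair _ _ _ _ _ d) => //; nia.
move=> nod; apply/negP => /exists_inP[S S_st /subsetP sijS].
have iS : i \in S by apply: sijS; rewrite !inE eqxx.
have jS : j \in S by apply: sijS; rewrite !inE eqxx orbT.
have [d [d_k d_s kd_s]] := stable_pair_bands _ _ _ _ _ _ le_sn S_st iS jS lt_ij.
by apply: nod; exists d; split; nia.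
Qed.

(** * Walks and powers of the cycle *)

Lemma has_walkP (T : finType) (e : rel T) x y m :
  reflect (exists p, [/\ size p = m, path e x p & last x p = y])
          (has_walk e x y m).
Proof.
apply: (iffP existsP) => [[p /andP[e_p /eqP lastp]]|[p [sz_p e_p lastp]]].
  by exists p; rewrite size_tuple.
by exists (Tuple (introT eqP sz_p)); rewrite /= e_p lastp eqxx.
Qed.

Lemma has_walk_sym (T : finType) (e : rel T) x y m :
  symmetric e -> has_walk e x y m -> has_walk e y x m.
Proof.
move=> e_sym /has_walkP[p [<- e_p <-]]; apply/has_walkP.
exists (rev (belast x p)); rewrite size_rev size_belast rev_path; split=> //.
  by rewrite (eq_path (e' := e)) // => u v; apply: e_sym.
by case: p {e_p} => //= z p; rewrite rev_cons last_rcons.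
Qed.

Lemma graph_powerE (T : finType) (e : rel T) q x y :
  graph_power e q x y = (x != y) && [exists d : 'I_q.+1, has_walk e x y d].
Proof.
rewrite /graph_power; congr (_ && _); apply/existsP/existsP.
  by case=> d /andP[walk_d _]; exists d.
case=> d walk_d; have ex_walk : exists m, has_walk e x y m by exists d.
have [m walk_m min_m] := ex_minnP ex_walk.
exists (Ordinal (leq_ltn_trans (min_m _ walk_d) (ltn_ord d))).
apply/andP; split=> //; apply/forallP => l; apply/negP => /min_m.
by rewrite leqNgt ltn_ord.
Qed.

Lemma ordSE n (x : 'I_n) : ordS x = (if x.+1 < n then x.+1 else 0) :> nat.
Proof.
have lt_xn := ltn_ord x; rewrite /= modn_wrap; last by lia.
by case: ifP => //; lia.
Qed.

Lemma cycle_walk_dist n (x y : 'I_n) m :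
    has_walk (cycle_graph n) x y m -> x <= y ->
  (y - x <= m) || (n - (y - x) <= m).
Proof.
move=> /has_walkP[p [sz_p e_p last_p]] le_xy.
(* A walk may step past [y] or across [0], so the induction needs a form that assumes no order
   between [x] and [y]. *)
suff : [|| (x <= y + m) && (y <= x + m), n + x <= y + m | n + y <= x + m] by lia.
elim: p x m sz_p e_p last_p {le_xy} => [|z p IHp] x m /= <-.
  by move=> _ ->; lia.
move=> /andP[e_xz e_p] /(IHp z _ erefl e_p); move: (size p) => {IHp e_p}m.
have [[lt_xn lt_yn] lt_zn] := (ltn_ord x, ltn_ord y, ltn_ord z).
case/orP: e_xz => /eqP/(congr1 (@nat_of_ord n)); rewrite ordSE.
  by case: ifP; lia.
by case: ifP; lia.
Qed.

Lemma cycle_walk_add n (x y : 'I_n) m :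
  y = (x + m) %% n :> nat -> has_walk (cycle_graph n) x y m.
Proof.
move=> y_xm; apply/has_walkP; exists (traject (@ordS n) (ordS x) m).
rewrite size_traject last_traject; split=> //.
  apply: sub_path (fpath_traject _ _ _) => u v /eqP <-.
  by rewrite /cycle_graph eqxx.
apply: val_inj; rewrite /= y_xm => {y y_xm}.
elim: m => [|m IHm]; first by rewrite addn0 modn_small.
by rewrite /= IHm addnS -[in LHS]addn1 -[in RHS]addn1 modnDml.
Qed.

Lemma cycle_powerE n q (x y : 'I_n) :
    x < y ->
  graph_power (cycle_graph n) q x y = (y - x <= q) || (n - (y - x) <= q).
Proof.
move=> lt_xy; have lt_yn := ltn_ord y.
rewrite graph_powerE -val_eqE /= neq_ltn lt_xy /=.
apply/existsP/orP => [[d /cycle_walk_dist/(_ (ltnW lt_xy))]|[le_q|le_q]].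
- by have := ltn_ord d; lia.
- exists (Ordinal (le_q : y - x < q.+1)); apply: cycle_walk_add.
  by rewrite /= subnKC ?(ltnW lt_xy) // modn_small.
(* The other arc climbs from [y] through [0] to [x]; its walk is then reversed. *)
exists (Ordinal (le_q : n - (y - x) < q.+1)).
apply/has_walk_sym/cycle_walk_add; first exact: cycle_graph_sym.
have -> : y + (n - (y - x)) = x + n by lia.
by rewrite modnDr modn_small.
Qed.

Lemma graph_power_sym (T : finType) (e : rel T) q :
  symmetric e -> symmetric (graph_power e q).
Proof.
move=> e_sym x y; rewrite !graph_powerE eq_sym; congr (_ && _).
by apply/existsP/existsP => -[d /has_walk_sym walk_d]; exists d; apply: walk_d.
Qed.

(** * Comparison of the bands with cyclic distance *)

Lemma G_cycle_power n k s :
    1 < k -> 0 < s -> s * (k + 1) - 1 <= n ->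
  G n k s =2 graph_power (cycle_graph n) (s - 1).
Proof.
move=> k_gt1 s_gt0 le_n i j.
wlog lt_ij : i j / i < j => [IH|].
  case: (ltngtP i j) => [/IH //|/IH|/val_inj ->].
    by rewrite G_sym graph_power_sym //; apply: cycle_graph_sym.
  by rewrite G_irr /graph_power eqxx.
have lt_jn := ltn_ord j.
have le_skn : s * k <= n by nia.
rewrite cycle_powerE //; apply/idP/idP => [/G_bands nod|near].
  apply: contraT => far; case: nod => //; first by lia.
  (* The last band reaches exactly [n - s]. Below its start, take [d] to be the quotient of [j - i]
     by [s]: the remainder is at most [s - 1 <= n - s * k]. *)
  have [le_D|gt_D] := leqP ((k - 1) * s) (j - i); first by exists (k - 1); nia.
  exists ((j - i) %/ s); have := divn_eq (j - i) s; have := ltn_pmod (j - i) s_gt0.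
  by move: (_ %/ _) (_ %% _) => a b; nia.
(* Every band lies within [[s, n - s]], so no near pair meets one. *)
by apply/G_bands => //; [lia | case=> d; nia].
Qed.

Theorem theorem3 (n s k : nat) (hk : 2 <= k) (hs : 3 <= s)
    (hn : s * k + 1 <= n) :
  (s * (k + 1) - 1 <= n ->
     graph_iso (G n k s) (graph_power (cycle_graph n) (s - 1))) /\
  (s * k + 1 <= n <= s * (k + 1) - 2 ->
     let r := n - s * k in
     forall i j : 'I_n,
       G n k s i j <->
       i <> j /\
       ~ (exists d : nat,
            1 <= d <= k - 1 /\ d * s <= `|j - i| <= d * s + r)).
Proof.
have [k_gt0 s_gt0] : 0 < k /\ 0 < s by lia.
have le_skn : s * k <= n by lia.
split=> [le_n|_ r i j].
  by exists id; [exists id | move=> x y; rewrite G_cycle_power // ltnW].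
wlog lt_ij : i j / i < j => [IH|].
  case: (ltngtP i j) => [/IH //|/IH|/val_inj ->].
    by rewrite G_sym distnC; case=> GB BG; split=> [/GB[]|[ne ?]];
      [split=> // /esym | apply: BG; split=> // /esym].
  by rewrite G_irr; split=> // -[].
rewrite G_bands // distnEl ?(ltnW lt_ij) //; split=> [nod|[]//].
by split=> // eq_ij; rewrite eq_ij ltnn in lt_ij.
Qed.
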